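(* Let $J\subset\mathbb R$ be an interval, let $\alpha_1,\dots,\alpha_m\colon J\to\mathbb R$ be continuous functions linearly independent on $J$, let $A_1,\dots,A_m$ be pairwise commuting real constant $n\times n$ matrices, and let $B_j=A_j^{T}$. Let $s\leq m/2$. Suppose the complex vectors $\nu^{\tau}=\overset{*}{\nu}{}^{\tau}+\widetilde\nu{}^{\tau} i$, $\nu^{s+\tau}=\overset{*}{\nu}{}^{\tau}-\widetilde\nu{}^{\tau} i$ ($\tau=1,\dots,s$), $\nu^{2s+1}=\overset{*}{\nu}{}^{2s+1}+\widetilde\nu{}^{2s+1} i$ (with $\overset{*}{\nu}{}^{\tau}=\mathrm{Re}\,\nu^{\tau}$, $\widetilde\nu{}^{\tau}=\mathrm{Im}\,\nu^{\tau}$ for $\tau=1,\dots,s,2s+1$) and the real vectors $\nu^{\theta}$ ($\theta=2s+2,\dots,m+1$) are linearly independent common eigenvectors of the matrices $B_j$, with $B_j\nu^{k}=\lambda^{j}_k\nu^{k}$, $j=1,\dots,m$, $k=1,\dots,m+1$. Let the complex numbers $h_k=\overset{*}{h}_k+\widetilde h_k i$ ($\overset{*}{h}_k=\mathrm{Re}\,h_k$, $\widetilde h_k=\mathrm{Im}\,h_k$), $k=1,\dots,m+1$, be a nontrivial solution of the system $$\sum_{k=1}^{m+1}\lambda^{j}_k\,h_k=0,\quad j=1,\dots,m.$$ Put, for $\tau=1,\dots,s$ and $\tau=2s+1$, $P_\tau(x)=(\overset{*}{\nu}{}^{\tau}x)^2+(\widetilde\nu{}^{\tau}x)^2$ and $\varphi_\tau(x)=\arctan\dfrac{\widetilde\nu{}^{\tau}x}{\overset{*}{\nu}{}^{\tau}x}$.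 Then the (Lappo-Danilevskii) system $\dfrac{dx}{dt}=\sum_{j=1}^{m}\alpha_j(t)A_jx$ has the autonomous first integrals $$F_1\colon x\mapsto\prod_{\tau=1}^{s}\bigl(P_\tau(x)\bigr)^{\overset{*}{h}_\tau+\overset{*}{h}_{s+\tau}}\exp\bigl(-2(\widetilde h_\tau-\widetilde h_{s+\tau})\varphi_\tau(x)\bigr)\cdot\bigl(P_{2s+1}(x)\bigr)^{\overset{*}{h}_{2s+1}}\exp\bigl(-2\widetilde h_{2s+1}\varphi_{2s+1}(x)\bigr)\prod_{\theta=2s+2}^{m+1}(\nu^{\theta}x)^{2\overset{*}{h}_\theta}$$ and $$F_2\colon x\mapsto\prod_{\tau=1}^{s}\bigl(P_\tau(x)\bigr)^{\widetilde h_\tau+\widetilde h_{s+\tau}}\exp\bigl(2(\overset{*}{h}_\tau-\overset{*}{h}_{s+\tau})\varphi_\tau(x)\bigr)\cdot\bigl(P_{2s+1}(x)\bigr)^{\widetilde h_{2s+1}}\exp\bigl(2\overset{*}{h}_{2s+1}\varphi_{2s+1}(x)\bigr)\prod_{\theta=2s+2}^{m+1}(\nu^{\theta}x)^{2\widetilde h_\theta}$$ for all $x\in\mathscr X$, where $\mathscr X\subset\mathbb R^n$ is any domain on which $F_1$ and $F_2$ (and all functions $\varphi_\tau$) are defined and $F_1,F_2$ are continuously differentiable.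
   Context: A domain is an open arcwise connected set. For a vector $\nu=(\nu_1,\dots,\nu_n)$ and $x\in\mathbb R^n$, $\nu x=\sum_{\xi=1}^n\nu_\xi x_\xi$; vectors are regarded as columns when multiplied by $B_j$. An autonomous first integral on $\mathscr X$ of $dx/dt=\sum_j\alpha_j(t)A_jx$ is a continuously differentiable function $F\colon\mathscr X\to\mathbb R$ with $\sum_{j=1}^m\alpha_j(t)\sum_{\xi=1}^n(A_jx)_\xi\,\partial_{x_\xi}F(x)=0$ for all $(t,x)\in J\times\mathscr X$. *)

(* Defs.v *)
From mathcomp Require Import all_boot all_order all_algebra.
From mathcomp Require Import complex.
From mathcomp Require Import all_classical all_reals all_analysis.
Set Implicit Arguments.
Unset Strict Implicit.
Unset Printing Implicit Defensive.
Import Order.TTheory GRing.Theory Num.Theory.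
Import numFieldNormedType.Exports.
Local Open Scope classical_set_scope.
Local Open Scope ring_scope.

Section Domains.
Variables (R : realType) (n : nat).

Definition arcwise_connected (X : set 'cV[R]_n) : Prop :=
  forall x y, X x -> X y ->
    exists g : R -> 'cV[R]_n,
      [/\ {within `[0, 1], continuous g}, g 0 = x, g 1 = y &
          forall t, t \in `[0, 1] -> X (g t)].

Definition domain (X : set 'cV[R]_n) : Prop := open X /\ arcwise_connected X.

Definition partial (xi : 'I_n) (F : 'cV[R]_n -> R) (x : 'cV[R]_n) : R :=
  'D_(delta_mx xi 0) F x.

(* Only used for open X, so that the values of F outside X are irrelevant. *)
Definition C1_on (X : set 'cV[R]_n) (F : 'cV[R]_n -> R) : Prop :=
  forall x, X x ->
    differentiable F x /\ forall xi, {for x, continuous (partial xi F)}.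

End Domains.

Section Systems.
Variables (R : realType) (m n : nat).
Variables (J : set R) (alpha : 'I_m -> R -> R) (A : 'I_m -> 'M[R]_n).

Definition lin_indep_on : Prop :=
  forall c : 'I_m -> R,
    (forall t, J t -> \sum_(j < m) c j * alpha j t = 0) -> forall j, c j = 0.

Definition autonomous_first_integral
    (X : set 'cV[R]_n) (F : 'cV[R]_n -> R) : Prop :=
  C1_on X F /\
  forall t x, J t -> X x ->
    \sum_(j < m) alpha j t *
      \sum_(xi < n) (A j *m x) xi 0 * partial xi F x = 0.

End Systems.

Section RealPower.
Variable R : realType.

(* |r| is a quotient of two odd natural numbers: the exponents r for which the
   real power y^r of a negative y is negative *)
Definition odd_over_odd (r : R) : bool :=
  `[< exists p q : nat, [/\ odd p, odd q & `|r| = p%:R / q%:R] >].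

(* y^(2h) for real y and h, where [powR] is only meaningful for bases >= 0.
   For y < 0 this is -|y|^(2h) if 2h is an odd integer or, more generally, a
   fraction with odd numerator and denominator, and (y^2)^h = |y|^(2h)
   otherwise. As for [powR], 0^0 = 1. *)
Definition powr2 (y h : R) : R :=
  if (y < 0) && odd_over_odd (2 * h) then - (`|y| `^ (2 * h))
  else `|y| `^ (2 * h).

Definition powr2_defined (y h : R) : Prop := y != 0 \/ 0 <= h.

End RealPower.

Section Integrals.
Variables (R : realType) (m n : nat).

Definition dotp (v x : 'cV[R]_n) : R := \sum_(xi < n) v xi 0 * x xi 0.

Definition re_vec (v : 'cV[R[i]]_n) : 'cV[R]_n := map_mx (@complex.Re R) v.
Definition im_vec (v : 'cV[R[i]]_n) : 'cV[R]_n := map_mx (@complex.Im R) v.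

Definition P_tau (v : 'cV[R[i]]_n) (x : 'cV[R]_n) : R :=
  dotp (re_vec v) x ^+ 2 + dotp (im_vec v) x ^+ 2.

Definition phi_tau (v : 'cV[R[i]]_n) (x : 'cV[R]_n) : R :=
  atan (dotp (im_vec v) x / dotp (re_vec v) x).

Definition phi_tau_defined (v : 'cV[R[i]]_n) (x : 'cV[R]_n) : Prop :=
  dotp (re_vec v) x != 0.

(* Indices are shifted by one: the vectors nu^1, ..., nu^(m+1) are
   nu 0, ..., nu m, the pairs being (tau, s + tau) for tau < s, the single
   complex vector having index 2s, and the real ones the indices k > 2s.
   [inord] is only applied to numbers <= m when 2s <= m. *)
Variables (s : nat) (nu : 'I_m.+1 -> 'cV[R[i]]_n) (h : 'I_m.+1 -> R[i]).

Definition reh (k : nat) : R := complex.Re (h (inord k)).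
Definition imh (k : nat) : R := complex.Im (h (inord k)).

Definition F1 (x : 'cV[R]_n) : R :=
  (\prod_(tau < s)
     (P_tau (nu (inord tau)) x `^ (reh tau + reh (s + tau)) *
      expR (- 2 * (imh tau - imh (s + tau)) * phi_tau (nu (inord tau)) x))) *
  (P_tau (nu (inord s.*2)) x `^ reh s.*2 *
   expR (- 2 * imh s.*2 * phi_tau (nu (inord s.*2)) x)) *
  \prod_(theta < m.+1 | (s.*2 < theta)%N)
     powr2 (dotp (re_vec (nu theta)) x) (reh theta).

Definition F2 (x : 'cV[R]_n) : R :=
  (\prod_(tau < s)
     (P_tau (nu (inord tau)) x `^ (imh tau + imh (s + tau)) *
      expR (2 * (reh tau - reh (s + tau)) * phi_tau (nu (inord tau)) x))) *
  (P_tau (nu (inord s.*2)) x `^ imh s.*2 *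
   expR (2 * reh s.*2 * phi_tau (nu (inord s.*2)) x)) *
  \prod_(theta < m.+1 | (s.*2 < theta)%N)
     powr2 (dotp (re_vec (nu theta)) x) (imh theta).

(* The powers of P_tau need no condition: P_tau x > 0 wherever phi_tau is
   defined. *)
Definition F12_defined (x : 'cV[R]_n) : Prop :=
  [/\ forall tau : 'I_s, phi_tau_defined (nu (inord tau)) x,
      phi_tau_defined (nu (inord s.*2)) x &
      forall theta : 'I_m.+1, (s.*2 < theta)%N ->
        powr2_defined (dotp (re_vec (nu theta)) x) (reh theta) /\
        powr2_defined (dotp (re_vec (nu theta)) x) (imh theta)].

End Integrals.

(* Main.v *)
(* Writing y_k = nu^k x, the eigenvector equations give
   (y_k)' = lambda^j_k y_k along the linear vector field x |-> A_j x.  Hence,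
   wherever no y_k vanishes, F1 and F2 have along this field the logarithmic
   derivatives 2 Re (sum_k lambda^j_k h_k) = 0 and
   2 Im (sum_k lambda^j_k h_k) = 0.  The real forms y_theta may vanish inside X,
   but only on hyperplanes; their complement is dense, and the derivative along
   the field is continuous, so it vanishes on all of X. *)
Require Import Defs.
From mathcomp Require Import all_boot all_order all_algebra.
From mathcomp Require Import complex.
From mathcomp Require Import all_classical all_reals all_analysis.
From mathcomp Require Import ring.
Import Order.TTheory GRing.Theory Num.Theory.
Import numFieldNormedType.Exports.
Local Open Scope classical_set_scope.
Local Open Scope ring_scope.

(** * Logarithmic derivatives of the factors, in one variable *)

Section LogarithmicDerivative.
Context {R : realType}.
Implicit Types (f g : R -> R) (x a b : R).

(** A logarithmic derivative [a] is recorded without division, as a derivative [f x * a]. In this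
    form the values multiply and the logarithmic derivatives add. *)
Lemma is_derive_logM f g x a b :
  is_derive x 1 f (f x * a) -> is_derive x 1 g (g x * b) ->
  is_derive x 1 (fun t => f t * g t) (f x * g x * (a + b)).
Proof.
move=> df dg; apply: (is_derive_eq (is_deriveM df dg)).
by rewrite /GRing.scale /=; ring.
Qed.

Lemma is_derive_log_prod (I : finType) (P : pred I) (f : I -> R -> R) x
    (a : I -> R) :
  (forall i, P i -> is_derive x 1 (f i) (f i x * a i)) ->
  is_derive x 1 (fun t => \prod_(i | P i) f i t)
    ((\prod_(i | P i) f i x) * \sum_(i | P i) a i).
Proof.
move=> df; elim: (index_enum I) => [|i r IH].
  rewrite (_ : (fun t => _) = cst 1); last by apply/funext=> t; rewrite big_nil.
  by rewrite !big_nil mulr0; exact: is_derive_cst.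
rewrite !big_cons (_ : (fun t => _) = fun t =>
    if P i then f i t * \prod_(j <- r | P j) f j t
    else \prod_(j <- r | P j) f j t); last first.
  by apply/funext=> t; rewrite big_cons.
by case: ifPn => // Pi; apply: is_derive_logM => //; exact: df.
Qed.

(* [p + q i] has logarithmic derivative [a + b i]. *)
Lemma is_derive_log_modulus_argument (p q : R -> R) x a b c d : p x != 0 ->
  is_derive x 1 p (a * p x - b * q x) -> is_derive x 1 q (a * q x + b * p x) ->
  let f t := (p t ^+ 2 + q t ^+ 2) `^ c * expR (d * atan (q t / p t)) in
  is_derive x 1 f (f x * (2 * c * a + d * b)).
Proof.
move=> px0 dp dq f.
have P0 : 0 < p x ^+ 2 + q x ^+ 2.
  by rewrite ltr_pwDl ?sqr_ge0// exprn_even_gt0.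
apply: is_derive_logM.
  have dP : is_derive x 1 (p ^+ 2 + q ^+ 2) ((p x ^+ 2 + q x ^+ 2) * (2 * a)).
    apply: (is_derive_eq (is_deriveD (is_deriveX _ dp) (is_deriveX _ dq))).
    by rewrite /GRing.scale /=; ring.
  have dpow : is_derive ((p ^+ 2 + q ^+ 2) x) 1 (@powR R ^~ c) _ :=
    is_derive1_powR c P0.
  apply: (is_derive_eq (is_derive1_comp dpow dP)).
  (* The chain rule leaves the exponent [c - 1]; the missing factor comes from the derivative of
     [p ^+ 2 + q ^+ 2], which is [2 * a] times itself. *)
  have powE : (p x ^+ 2 + q x ^+ 2) `^ c =
      (p x ^+ 2 + q x ^+ 2) `^ (c - 1) * (p x ^+ 2 + q x ^+ 2).
    rewrite -{1}(subrK 1 c) (powRD (r := c - 1)) ?powRr1 ?(ltW P0)//.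
    by rewrite (gt_eqF P0) implybT.
  by rewrite powE; ring.
(* The derivative of [atan (q / p)] is [(q' p - q p') / (p ^ 2 + q ^ 2)], which equals [b] because
   the terms in [a] cancel. *)
have dV := is_deriveV px0 dp.
have dA := is_derive1_comp (is_derive1_atan _) (is_deriveM dq dV).
apply: (is_derive_eq (is_derive1_comp (is_derive_expR _) (is_deriveZ d dA))).
rewrite /GRing.scale /=; congr (_ * (_ * _)).
rewrite -[(q * _) x]/(q x / p x); field.
by rewrite px0 gt_eqF.
Qed.

(** Up to a locally constant sign, this is the preceding lemma with [q = 0] and [d = 0]. *)
Lemma is_derive_log_powr2 (p : R -> R) x a e : p x != 0 ->
  is_derive x 1 p (a * p x) ->
  is_derive x 1 (fun t => powr2 (p t) e) (powr2 (p x) e * (2 * e * a)).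
Proof.
move=> px0 dp.
have pc : {for x, continuous p}.
  by apply/differentiable_continuous/derivable1_diffP; case: dp.
pose sg (t : R) : R := if (t < 0) && odd_over_odd (2 * e) then -1 else 1.
(* the sign of [p] is constant near [x], where [powr2 y e] is a multiple of
   [(y ^ 2) `^ e] *)
have powr2E t : powr2 t e = sg t * (t ^+ 2 + 0 ^+ 2) `^ e.
  rewrite expr0n/= addr0 -[t ^+ 2]real_normK ?num_real// -powR_mulrn// -powRrM.
  by rewrite /powr2 /sg; case: ifP; rewrite ?mulN1r ?mul1r.
have sgE : \forall t \near x, sg (p t) = sg (p x).
  rewrite /sg; case: (ltgtP (p x) 0) px0 => // [pn|pp] _.
    near=> t; suff -> : p t < 0 by [].
    by near: t; exact: (pc _ (lt_nbhsl pn)).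
  near=> t; suff pt : 0 < p t by rewrite !ltNge !ltW.
  by near: t; exact: (pc _ (lt_nbhsr pp)).
have dq : is_derive x 1 (cst 0 : R -> R) (a * 0 + 0 * p x).
  by rewrite mulr0 mul0r addr0; exact: is_derive_cst.
have dp' : is_derive x 1 p (a * p x - 0 * cst 0 x) by rewrite mul0r subr0.
have := is_derive_log_modulus_argument p (cst 0) x a 0 e 0 px0 dp' dq.
move=> /(is_deriveZ (sg (p x))) df.
apply: (near_eq_is_derive _ (is_derive_eq df _)).
  near=> t; rewrite powr2E /= /GRing.scale /= mul0r expR0 mulr1.
  by congr (_ * _); near: t; apply: filterS sgE => t ->.
by rewrite powr2E /= /GRing.scale /= !mul0r expR0; ring.
Unshelve. all: by end_near. Qed.

End LogarithmicDerivative.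

(** * Linear forms along lines, hyperplanes, and real parts of eigenvectors *)

Section LinearForms.
Context {R : realType} {n : nat}.
Implicit Types (v w x : 'cV[R]_n) (F : 'cV[R]_n -> R).

Lemma dotp_line v w x t : dotp v (t *: w + x) = t * dotp v w + dotp v x.
Proof.
rewrite /dotp mulr_sumr -big_split; apply: eq_bigr => i _ /=.
by rewrite !mxE; ring.
Qed.

Lemma dotpE v x : dotp v x = (v^T *m x) 0 0.
Proof. by rewrite mxE; apply: eq_bigr => i _; rewrite mxE. Qed.

Lemma dotp_mulmx (A : 'M[R]_n) v x : dotp v (A *m x) = dotp (A^T *m v) x.
Proof. by rewrite !dotpE trmx_mul trmxK mulmxA. Qed.

Lemma is_derive_dotp_line v w x :
  is_derive (0 : R) 1 (fun t => dotp v (t *: w + x)) (dotp v w).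
Proof.
rewrite (_ : (fun t => _) = (dotp v w \*: id) + cst (dotp v x)); last first.
  by apply/funext => t; rewrite dotp_line mulrC.
apply: (is_derive_eq (is_deriveD (is_deriveZ (dotp v w)
  (is_derive_id (0 : R) 1)) (is_derive_cst _ _ _))).
by rewrite addr0 /GRing.scale /= mulr1.
Qed.

(** Both sides are limits of the same difference quotient. This brings derivatives along the vector
    field under the one-variable rules. *)
Lemma derive_line F w x : 'D_w F x = 'D_1 (fun t : R => F (t *: w + x)) 0.
Proof.
rewrite /derive; apply: (congr1 (fun f : R -> R => lim (f @ 0^'))).
by apply/funext => t /=; rewrite addr0 scale0r add0r /GRing.scale /= mulr1.
Qed.

Lemma sum_partial F w x : differentiable F x ->
  \sum_(i < n) w i 0 * partial i F x = 'D_w F x.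
Proof.
move=> dF; rewrite deriveE// [in RHS](matrix_sum_delta w) linear_sum.
apply: eq_bigr => i _; rewrite big_ord1 linearZ /partial deriveE//.
Qed.

(** The vector is sought on the moment curve with entries [t ^ k]: there each form is a nonzero
    polynomial in [t], and finitely many such polynomials have a common non-root. *)
Lemma exists_nonorthogonal (I : finType) (P : pred I) (v : I -> 'cV[R]_n) :
  (forall i, P i -> v i != 0) -> exists w, forall i, P i -> dotp (v i) w != 0.
Proof.
move=> v0; pose p i : {poly R} := \sum_(k < n) v i k 0 *: 'X^k.
have p0 : \prod_(i | P i) p i != 0.
  apply/prodf_neq0 => i /v0; apply: contraNneq => pi0.
  apply/eqP/colP => k; rewrite mxE.
  have /(congr1 (fun q : {poly R} => q`_k)) := pi0.
  rewrite coef0 coef_sum (bigD1 k)//= big1 => [|j jk].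
    by rewrite addr0 coefZ coefXn eqxx mulr1.
  by rewrite coefZ coefXn (inj_eq val_inj) eq_sym (negbTE jk) mulr0.
have [t pt0] : exists t, ~~ root (\prod_(i | P i) p i) t.
  (* These are more distinct points than the degree of the product, so they cannot all be roots. *)
  pose rs := [seq k%:R : R | k <- iota 0 (size (\prod_(i | P i) p i))].
  have /allPn[t _ ?] : ~~ all (root (\prod_(i | P i) p i)) rs.
    apply/negP => /(max_poly_roots p0).
    rewrite map_inj_uniq ?iota_uniq; last first.
      by move=> ? ? /eqP; rewrite eqr_nat => /eqP.
    by move=> /(_ isT); rewrite size_map size_iota ltnn.
  by exists t.
exists (\col_k t ^+ k) => i Pi; move: pt0.
rewrite rootE horner_prod => /prodf_neq0/(_ i Pi).
rewrite horner_sum /dotp; under eq_bigr do rewrite hornerZ hornerXn.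
by under [in X in _ -> X]eq_bigr do rewrite mxE.
Qed.

(** A line through [x] in a direction transverse to all the hyperplanes meets each of them at most
    once. So [F] vanishes on the line near [x], except perhaps at [x] itself, and continuity gives
    the value there. *)
Lemma continuous_eq0_off_hyperplanes (I : finType) (P : pred I)
    (v : I -> 'cV[R]_n) (X : set 'cV[R]_n) F x :
  (forall i, P i -> v i != 0) -> open X -> X x -> {for x, continuous F} ->
  (forall y, X y -> (forall i, P i -> dotp (v i) y != 0) -> F y = 0) ->
  F x = 0.
Proof.
move=> /exists_nonorthogonal[w vw] oX Xx Fx F0.
have line : t *: w + x @[t --> (0 : R)^'] --> x.
  have /continuous_withinNx : {for 0, continuous (fun t : R => t *: w + x)}.
    by apply: cvgD; [apply: cvgZr_tmp; exact: cvg_id|exact: cvg_cst].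
  by rewrite scale0r add0r.
have Fline : F (t *: w + x) @[t --> (0 : R)^'] --> F x.
  exact: cvg_comp line Fx.
have near0 : \forall t \near (0 : R)^', F (t *: w + x) = 0.
  near=> t; apply: F0.
    by near: t; apply: line; exact: open_nbhs_nbhs.
  near: t; apply: filter_forall => i.
  case: (boolP (P i)) => [Pi|_]; last exact: nearW.
  (* [c] is the only parameter at which the line can meet the hyperplane. If [c = 0], the punctured
     neighbourhood excludes it; otherwise [|t| < |c|] does. *)
  have [c neq] : exists c, forall t, dotp (v i) (t *: w + x) = 0 -> t = c.
    exists (- dotp (v i) x / dotp (v i) w) => t; rewrite dotp_line => /eqP.
    by rewrite addr_eq0 => /eqP <-; rewrite mulfK// vw.
  have [c0|c0] := eqVneq c 0.
    apply: filterS (nbhs_dnbhs_neq (0 : R)) => t t0 _.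
    by apply: contraNneq t0 => /neq ->; rewrite c0.
  have c_gt0 : 0 < `|c| by rewrite normr_gt0.
  apply: filterS (dnbhs0_lt (V := R) c_gt0) => t tc _.
  by apply: contraTneq tc => /neq ->; rewrite ltxx.
apply: (cvg_unique _ Fline); first exact: Rhausdorff.
apply: cvg_near_cst.
exact: near0.
Unshelve. all: by end_near. Qed.

Lemma continuous_mulmx_entry (A : 'M[R]_n) (i : 'I_n) :
  continuous (fun x : 'cV[R]_n => (A *m x) i 0).
Proof.
rewrite (_ : (fun x => _) = fun x => \sum_k A i k * x k 0); last first.
  by apply/funext => x; rewrite mxE.
have entry k : continuous (fun x : 'cV[R]_n => A i k * x k 0).
  move=> x; apply: continuousM; first exact: cst_continuous.
  exact: coord_continuous.
move=> x; apply: cvg_big => [||k _]; last exact: entry.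
- exact: add_continuous.
- exact: nbhs_filter.
Qed.

Lemma Re_sum (I : finType) (f : I -> R[i]) :
  complex.Re (\sum_i f i) = \sum_i complex.Re (f i).
Proof. by apply: (big_morph (@complex.Re R)) => // -[? ?] [? ?]. Qed.

Lemma Im_sum (I : finType) (f : I -> R[i]) :
  complex.Im (\sum_i f i) = \sum_i complex.Im (f i).
Proof. by apply: (big_morph (@complex.Im R)) => // -[? ?] [? ?]. Qed.

Lemma ReM (z t : R[i]) : complex.Re (z * t) =
  complex.Re z * complex.Re t - complex.Im z * complex.Im t.
Proof. by case: z t => [? ?] [? ?]. Qed.

Lemma ImM (z t : R[i]) : complex.Im (z * t) =
  complex.Re z * complex.Im t + complex.Im z * complex.Re t.
Proof. by case: z t => [? ?] [? ?]. Qed.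

(** As [A] is real, the eigenvector equation splits into real and imaginary parts. The result has
    the shape required by [is_derive_log_modulus_argument], with [a + b i = l]. *)
Lemma eigen_re_im (A : 'M[R]_n) (nu : 'cV[R[i]]_n) (l : R[i]) :
  map_mx (real_complex R) A^T *m nu = l *: nu ->
  A^T *m re_vec nu = complex.Re l *: re_vec nu - complex.Im l *: im_vec nu /\
  A^T *m im_vec nu = complex.Re l *: im_vec nu + complex.Im l *: re_vec nu.
Proof.
move=> eig; split; apply/colP => k; have /colP/(_ k) := eig; rewrite !mxE.
  move=> /(congr1 (@complex.Re R)); rewrite Re_sum ReM => <-.
  by apply: eq_bigr => j _; rewrite !mxE ReM /= mul0r subr0.
move=> /(congr1 (@complex.Im R)); rewrite Im_sum ImM => <-.
by apply: eq_bigr => j _; rewrite !mxE ImM /= mul0r addr0.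
Qed.

End LinearForms.

(** * Products of powers of eigenforms and their derivative along the linear fields *)

Section DarbouxProduct.
Context {R : realType} {m n : nat}.
Context (s : nat) (nu : 'I_m.+1 -> 'cV[R[i]]_n).

Lemma sum_conjugate_pairs (f : 'I_m.+1 -> R) : (s.*2 <= m)%N ->
  \sum_k f k = \sum_(tau < s) (f (inord tau) + f (inord (s + tau))) +
    f (inord s.*2) + \sum_(theta < m.+1 | (s.*2 < theta)%N) f theta.
Proof.
move=> s2m; under eq_bigr do rewrite -[X in f X]inord_val.
under [X in _ = _ + X]eq_bigr do rewrite -[X in f X]inord_val.
rewrite -(big_mkord xpredT (fun k => f (inord k))).
rewrite -(big_mkord (fun k => s.*2 < k)%N (fun k => f (inord k))).
rewrite (@big_cat_nat _ _ _ s.*2.+1 0 m.+1)//=.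
rewrite (@big_cat_nat _ _ _ s.*2.+1 0 m.+1 (fun k => s.*2 < k)%N)//=.
congr (_ + _); last first.
  rewrite [X in _ = X + _]big1_seq ?add0r => [|k]; last first.
    by rewrite mem_index_iota ltnS ltnNge => /andP[/negP sk /andP[_ /sk]].
  by apply: congr_big_nat => // k /andP[->].
(* Index [2s] is split off; the indices below it are cut at [s], and the upper half is shifted down
   by [s]. *)
rewrite big_nat_recr//=; congr (_ + _).
rewrite big_split/= (@big_cat_nat _ _ _ s 0 s.*2)//=; last first.
  by rewrite -addnn leq_addr.
rewrite big_mkord; congr (_ + _).
rewrite -{1}[s]add0n big_addn -addnn addnK big_mkord.
by apply: eq_bigr => i _; rewrite addnC.
Qed.

(** [F1] and [F2] differ only in their exponents; with the exponents as parameters, one computation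
    serves both. *)
Definition darboux_product (c d : 'I_s -> R) (c0 d0 : R) (e : 'I_m.+1 -> R)
    (x : 'cV[R]_n) : R :=
  (\prod_(tau < s)
     (P_tau (nu (inord tau)) x `^ c tau *
      expR (d tau * phi_tau (nu (inord tau)) x))) *
  (P_tau (nu (inord s.*2)) x `^ c0 *
   expR (d0 * phi_tau (nu (inord s.*2)) x)) *
  \prod_(theta < m.+1 | (s.*2 < theta)%N)
     powr2 (dotp (re_vec (nu theta)) x) (e theta).

Context (nu_real :
  forall theta : 'I_m.+1, (s.*2 < theta)%N -> im_vec (nu theta) = 0).

Lemma derive_darboux_product (A : 'M[R]_n) (l : 'I_m.+1 -> R[i]) c d c0 d0 e
    (x : 'cV[R]_n) :
  (forall k, map_mx (real_complex R) A^T *m nu k = l k *: nu k) ->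
  (forall tau : 'I_s, phi_tau_defined (nu (inord tau)) x) ->
  phi_tau_defined (nu (inord s.*2)) x ->
  (forall theta : 'I_m.+1, (s.*2 < theta)%N ->
    dotp (re_vec (nu theta)) x != 0) ->
  'D_(A *m x) (darboux_product c d c0 d0 e) x =
  darboux_product c d c0 d0 e x *
  (\sum_(tau < s) (2 * c tau * complex.Re (l (inord tau)) +
                   d tau * complex.Im (l (inord tau))) +
   (2 * c0 * complex.Re (l (inord s.*2)) + d0 * complex.Im (l (inord s.*2))) +
   \sum_(theta < m.+1 | (s.*2 < theta)%N)
      2 * e theta * complex.Re (l theta)).
Proof.
move=> eig phi_def phi0_def re0; rewrite derive_line.
(* [p k + i q k] is the eigenform of [nu k] on the tangent line to the field at [x]; its derivative
   at 0 is [l k] times its value. *)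
pose p k (t : R) := dotp (re_vec (nu k)) (t *: (A *m x) + x).
pose q k (t : R) := dotp (im_vec (nu k)) (t *: (A *m x) + x).
have p0E k : p k 0 = dotp (re_vec (nu k)) x by rewrite /p scale0r add0r.
have q0E k : q k 0 = dotp (im_vec (nu k)) x by rewrite /q scale0r add0r.
have dotp_comb a b (v w : 'cV[R]_n) :
    dotp (a *: v + b *: w) x = a * dotp v x + b * dotp w x.
  rewrite /dotp !mulr_sumr -big_split; apply: eq_bigr => i _ /=.
  by rewrite !mxE; ring.
have dp k : is_derive (0 : R) 1 (p k)
    (complex.Re (l k) * p k 0 - complex.Im (l k) * q k 0).
  apply: (is_derive_eq (is_derive_dotp_line _ _ _)).
  have [eigE _] := eigen_re_im _ _ _ (eig k).
  by rewrite dotp_mulmx eigE -scaleNr dotp_comb p0E q0E mulNr.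
have dq k : is_derive (0 : R) 1 (q k)
    (complex.Re (l k) * q k 0 + complex.Im (l k) * p k 0).
  apply: (is_derive_eq (is_derive_dotp_line _ _ _)).
  have [_ eigE] := eigen_re_im _ _ _ (eig k).
  by rewrite dotp_mulmx eigE dotp_comb p0E q0E.
have dmodarg k (a b : R) : phi_tau_defined (nu k) x ->
    is_derive (0 : R) 1
      (fun t => (p k t ^+ 2 + q k t ^+ 2) `^ a *
                expR (b * atan (q k t / p k t)))
      ((p k 0 ^+ 2 + q k 0 ^+ 2) `^ a * expR (b * atan (q k 0 / p k 0)) *
       (2 * a * complex.Re (l k) + b * complex.Im (l k))).
  by move=> def; apply: is_derive_log_modulus_argument => //; rewrite p0E.
have dreal (k : 'I_m.+1) : (s.*2 < k)%N ->
    is_derive (0 : R) 1 (fun t => powr2 (p k t) (e k))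
      (powr2 (p k 0) (e k) * (2 * e k * complex.Re (l k))).
  move=> sk; apply: is_derive_log_powr2; first by rewrite p0E re0.
  (* For a real eigenvector [q k] vanishes, so the term with the imaginary part of the eigenvalue
     drops out. *)
  apply: (is_derive_eq (dp k)); rewrite [q k 0]q0E nu_real//.
  by rewrite /dotp big1 ?mulr0 ?subr0// => i _; rewrite mxE mul0r.
have dpairs := is_derive_log_prod _ xpredT _ _ _ (fun (tau : 'I_s) _ =>
  dmodarg (inord tau) (c tau) (d tau) (phi_def tau)).
have dsingle := dmodarg (inord s.*2) c0 d0 phi0_def.
have dF := is_derive_logM _ _ _ _ _ (is_derive_logM _ _ _ _ _ dpairs dsingle)
  (is_derive_log_prod _ _ _ _ _ dreal).
rewrite (derive_val (is_derive := dF)) /=; congr (_ * _).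
rewrite /darboux_product /P_tau /phi_tau -!p0E -!q0E; congr (_ * _ * _).
  by apply: eq_bigr => tau _; rewrite -!p0E -!q0E.
by apply: eq_bigr => k _; rewrite -!p0E.
Qed.

Lemma darboux_first_integral (J : set R) (alpha : 'I_m -> R -> R)
    (A : 'I_m -> 'M[R]_n) (lambda : 'I_m -> 'I_m.+1 -> R[i]) c d c0 d0 e
    (X : set 'cV[R]_n) :
  (forall j k, map_mx (real_complex R) (A j)^T *m nu k = lambda j k *: nu k) ->
  (forall k, nu k != 0) -> open X ->
  (forall x, X x -> (forall tau : 'I_s, phi_tau_defined (nu (inord tau)) x) /\
                    phi_tau_defined (nu (inord s.*2)) x) ->
  C1_on X (darboux_product c d c0 d0 e) ->
  (forall j,
    \sum_(tau < s) (2 * c tau * complex.Re (lambda j (inord tau)) +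
                    d tau * complex.Im (lambda j (inord tau))) +
    (2 * c0 * complex.Re (lambda j (inord s.*2)) +
     d0 * complex.Im (lambda j (inord s.*2))) +
    \sum_(theta < m.+1 | (s.*2 < theta)%N)
      2 * e theta * complex.Re (lambda j theta) = 0) ->
  autonomous_first_integral J alpha A X (darboux_product c d c0 d0 e).
Proof.
move=> eig nu0 oX def C1 weight0; split=> // t x Jt Xx.
(* The derivative along each field [A j] vanishes separately, whatever the coefficients
   [alpha j t]. *)
rewrite big1// => j _; apply/eqP; rewrite mulf_eq0; apply/orP; right; apply/eqP.
have re_nu0 (k : 'I_m.+1) : (s.*2 < k)%N -> re_vec (nu k) != 0.
  move=> sk; apply: contra_neq (nu0 k) => re0.
  apply/colP => i; move/colP/(_ i): re0; move/colP/(_ i): (nu_real _ sk).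
  by rewrite !mxE; case: (nu k i 0) => a b /= -> ->.
pose F := darboux_product c d c0 d0 e.
apply: (continuous_eq0_off_hyperplanes _ _ _ X
  (fun y => \sum_xi (A j *m y) xi 0 * partial xi F y) _ re_nu0) => //.
  have term xi :
      {for x, continuous (fun y => (A j *m y) xi 0 * partial xi F y)}.
    by apply: continuousM; [exact: continuous_mulmx_entry|case: (C1 x Xx)].
  apply: cvg_big => [||xi _]; last exact: term.
  - exact: add_continuous.
  - exact: nbhs_filter.
move=> y Xy y0; have [phi_def phi0_def] := def y Xy.
rewrite sum_partial; last by case: (C1 y Xy).
by rewrite (derive_darboux_product _ (lambda j))// weight0 mulr0.
Qed.

End DarbouxProduct.

(** * The two first integrals *)

Theorem theorem2p10 (R : realType) (m n s : nat) (J : set R)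
    (alpha : 'I_m -> R -> R) (A : 'I_m -> 'M[R]_n)
    (nu : 'I_m.+1 -> 'cV[R[i]]_n) (lambda : 'I_m -> 'I_m.+1 -> R[i])
    (h : 'I_m.+1 -> R[i]) (X : set 'cV[R]_n)
    (J_itv : is_interval J)
    (alpha_cont : forall j, {within J, continuous (alpha j)})
    (alpha_indep : lin_indep_on J alpha)
    (A_comm : forall j l, comm_mx (A j) (A l))
    (s_le : (s.*2 <= m)%N)
    (nu_conj : forall tau : 'I_s,
       nu (inord (s + tau)) = map_mx (@conjc R) (nu (inord tau)))
    (nu_real : forall theta : 'I_m.+1, (s.*2 < theta)%N -> im_vec (nu theta) = 0)
    (nu_free : free [seq nu k | k : 'I_m.+1])
    (nu_eigen : forall j k,
       map_mx (real_complex R) (A j)^T *m nu k = lambda j k *: nu k)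
    (h_sol : forall j, \sum_(k < m.+1) lambda j k * h k = 0)
    (h_nontrivial : exists k, h k != 0)
    (X_domain : domain X)
    (F_defined : forall x, X x -> F12_defined s nu h x)
    (F1_C1 : C1_on X (F1 s nu h))
    (F2_C1 : C1_on X (F2 s nu h)) :
  autonomous_first_integral J alpha A X (F1 s nu h) /\
  autonomous_first_integral J alpha A X (F2 s nu h).
Proof.
have [X_open _] := X_domain.
have nu0 k : nu k != 0.
  move: nu_free; rewrite free_directv => /andP[nz _].
  by apply: contraNneq nz => <-; rewrite map_f// mem_enum.
have def x : X x -> (forall tau : 'I_s, phi_tau_defined (nu (inord tau)) x) /\
    phi_tau_defined (nu (inord s.*2)) x by case/F_defined.
(* Conjugating the equation for [nu tau], with [A j] real, gives a second eigenvalue for the nonzero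
   vector [nu (s + tau)]; the two must agree. *)
have lambda_conj j (tau : 'I_s) :
    lambda j (inord (s + tau)) = conjc (lambda j (inord tau)).
  have := nu_eigen j (inord tau) => /(congr1 (map_mx (@conjc R))).
  rewrite map_mxM map_mxZ -map_mx_comp -nu_conj /=.
  rewrite (_ : map_mx _ (A j)^T = map_mx (real_complex R) (A j)^T); last first.
    by apply/matrixP => a b; rewrite !mxE /= oppr0.
  rewrite nu_eigen => /eqP; rewrite -subr_eq0 -scalerBl scaler_eq0.
  by rewrite (negbTE (nu0 _)) orbF subr_eq0 => /eqP.
(* The imaginary part of the eigenvector equation reduces to [Im lambda * re_vec nu = 0], and the
   real part of a nonzero real vector is nonzero. *)
have lambda_real j (theta : 'I_m.+1) : (s.*2 < theta)%N ->
    complex.Im (lambda j theta) = 0.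
  move=> sk; have im0 := nu_real _ sk.
  have [_] := eigen_re_im _ _ _ (nu_eigen j theta).
  rewrite im0 mulmx0 scaler0 add0r => /esym/eqP; rewrite scaler_eq0.
  case/orP => [/eqP //|/eqP re0]; case/eqP: (nu0 theta); apply/colP => i.
  move/colP/(_ i): re0; move/colP/(_ i): im0; rewrite !mxE.
  by case: (nu theta i 0) => a b /= -> ->.
split.
- apply: (darboux_first_integral s nu nu_real J alpha A lambda
    (fun tau => reh h tau + reh h (s + tau))
    (fun tau => - 2 * (imh h tau - imh h (s + tau)))
    (reh h s.*2) (- 2 * imh h s.*2) (fun theta => reh h theta)) => // j.
  (* The factor 2 arises because [P_tau] is a squared modulus. With [lambda = a + b i] on [tau] and
     [a - b i] on [s + tau], a pair contributes [2 a] times the sum of the real parts of [h] minus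
     [2 b] times the difference of the imaginary parts. *)
  have := congr1 (fun z => 2 * complex.Re z) (h_sol j).
  rewrite mulr0 Re_sum mulr_sumr (sum_conjugate_pairs s)//; apply: etrans.
  congr (_ + _ + _).
  + apply: eq_bigr => tau _; rewrite !ReM lambda_conj /reh /imh.
    by case: (lambda j _) => a b /=; ring.
  + by rewrite ReM /reh /imh; ring.
  + by apply: eq_bigr => k sk; rewrite ReM lambda_real// /reh inord_val; ring.
- apply: (darboux_first_integral s nu nu_real J alpha A lambda
    (fun tau => imh h tau + imh h (s + tau))
    (fun tau => 2 * (reh h tau - reh h (s + tau)))
    (imh h s.*2) (2 * reh h s.*2) (fun theta => imh h theta)) => // j.
  (* Here a pair contributes [2 a] times the sum of the imaginary parts of [h] plus [2 b] times the
     difference of the real parts. *)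
  have := congr1 (fun z => 2 * complex.Im z) (h_sol j).
  rewrite mulr0 Im_sum mulr_sumr (sum_conjugate_pairs s)//; apply: etrans.
  congr (_ + _ + _).
  + apply: eq_bigr => tau _; rewrite !ImM lambda_conj /reh /imh.
    by case: (lambda j _) => a b /=; ring.
  + by rewrite ImM /reh /imh; ring.
  + by apply: eq_bigr => k sk; rewrite ImM lambda_real// /imh inord_val; ring.
Qed.
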